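(* For every real $r>0$, the quandle $S^2_1(r)$ is not isomorphic (as a quandle) to the quandle ${S^2_1}_{\mathbb{R}}$.
   Context: A quandle is a set $X$ with a binary operation $\triangleright$ such that (Q1) $x\triangleright x=x$ for all $x$; (Q2) for every $y$ the map $x\mapsto x\triangleright y$ is a bijection of $X$; (Q3) $(x\triangleright y)\triangleright z=(x\triangleright z)\triangleright(y\triangleright z)$ for all $x,y,z$. A quandle isomorphism is a bijection $f$ with $f(x\triangleright y)=f(x)\triangleright f(y)$ for all $x,y$. For $r>0$, $S^2_1(r)=\{g^{-1}\begin{pmatrix}e^r&0\\0&e^{-r}\end{pmatrix}g : g\in SL(2,\mathbb{R})\}\subset SL(2,\mathbb{R})$, regarded as a quandle with the operation $x\triangleright y=y^{-1}xy$. Let $\langle(x_0,x_1,x_2),(y_0,y_1,y_2)\rangle=-x_0y_0+x_1y_1+x_2y_2$ on $\mathbb{R}^3$ and $S^2_1=\{\bm{x}\in\mathbb{R}^3:\langle\bm{x},\bm{x}\rangle=1\}$. The quandle ${S^2_1}_{\mathbb{R}}$ is the set $S^2_1$ with the operation $\bm{x}\triangleright\bm{y}=2\langle\bm{x},\bm{y}\rangle\bm{y}-\bm{x}$. *)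

(* Defs.v *)
From mathcomp Require Import all_boot all_order all_algebra.
From mathcomp Require Import boolp classical_sets reals sequences exp.
From mathcomp Require Import ring.

Set Implicit Arguments.
Unset Strict Implicit.
Unset Printing Implicit Defensive.

Import Order.TTheory GRing.Theory Num.Theory.
Local Open Scope classical_set_scope.
Local Open Scope ring_scope.

Record quandle := Quandle {
  quandle_sort :> Type;
  qop : quandle_sort -> quandle_sort -> quandle_sort;
  qop_idem : forall x, qop x x = x;
  qop_bij : forall y, bijective (fun x => qop x y);
  qop_distr : forall x y z, qop (qop x y) z = qop (qop x z) (qop y z)
}.

Definition quandle_iso (X Y : quandle) (f : X -> Y) : Prop :=
  bijective f /\ forall x y : X, f (qop x y) = qop (f x) (f y).

Definition quandle_isomorphic (X Y : quandle) : Prop :=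
  exists f : X -> Y, quandle_iso f.

Section ConjugationQuandle.
Variable R : realType.

(* 'GL_n in MathComp is only available over finite rings, so SL(2, R) is the
   set of 2 x 2 matrices of determinant 1. *)
Definition SL2 : set 'M[R]_2 := [set g | \det g = 1].

Lemma SL2_unit (g : 'M[R]_2) : SL2 g -> g \in unitmx.
Proof. by move=> g1; rewrite unitmxE g1 unitr1. Qed.

Lemma SL2_mul (g h : 'M[R]_2) : SL2 g -> SL2 h -> SL2 (g *m h).
Proof. by rewrite /SL2 /= det_mulmx => -> ->; rewrite mulr1. Qed.

Lemma SL2_inv (g : 'M[R]_2) : SL2 g -> SL2 (invmx g).
Proof. by rewrite /SL2 /= det_inv => ->; rewrite invr1. Qed.

Definition diag_exp (r : R) : 'M[R]_2 :=
  diag_mx (\row_(i < 2) if i == 0 then expR r else expR (- r)).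

(* The conjugacy class of diag(e^r, e^-r) in SL(2, R). *)
Definition S21 (r : R) : set 'M[R]_2 :=
  [set invmx g *m diag_exp r *m g | g in SL2].

Lemma diag_exp_SL2 (r : R) : SL2 (diag_exp r).
Proof. by rewrite /SL2 /= det_diag !big_ord_recl big_ord0 !mxE mulr1 -expRD subrr expR0. Qed.

Lemma S21_SL2 (r : R) : S21 r `<=` SL2.
Proof.
move=> _ [g g1 <-]; apply: SL2_mul => //; apply: SL2_mul; first exact: SL2_inv.
exact: diag_exp_SL2.
Qed.

Lemma invmxM (g h : 'M[R]_2) : SL2 g -> SL2 h ->
  invmx (g *m h) = invmx h *m invmx g.
Proof.
move=> g1 h1; have gu := SL2_unit g1; have hu := SL2_unit h1.
have ghu := SL2_unit (SL2_mul g1 h1).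
apply: (can_inj (mulKmx ghu)); rewrite mulmxV //.
by rewrite !mulmxA -(mulmxA g) mulmxV // mulmx1 mulmxV.
Qed.

Lemma S21_conj (r : R) (x y : 'M[R]_2) :
  S21 r x -> SL2 y -> S21 r (invmx y *m x *m y).
Proof.
move=> [g g1 <-] y1; exists (g *m y); first exact: SL2_mul.
by rewrite invmxM // !mulmxA.
Qed.

Lemma S21_op_subproof (r : R) (x y : S21 r) :
  invmx (val y) *m val x *m val y \in S21 r.
Proof.
apply/mem_set/S21_conj; first exact: set_valP.
exact/S21_SL2/set_valP.
Qed.

Definition S21_op (r : R) (x y : S21 r) : S21 r :=
  exist _ (invmx (val y) *m val x *m val y) (S21_op_subproof x y).

Lemma S21_op_inv_subproof (r : R) (x y : S21 r) :
  val y *m val x *m invmx (val y) \in S21 r.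
Proof.
have y1 : SL2 (val y) by exact/S21_SL2/set_valP.
apply/mem_set; rewrite -{1}[val y]invmxK; apply: S21_conj; first exact: set_valP.
exact: SL2_inv.
Qed.

Lemma S21_valU (r : R) (x : S21 r) : val x \in unitmx.
Proof. exact/SL2_unit/S21_SL2/set_valP. Qed.

Lemma S21_op_idem (r : R) (x : S21 r) : S21_op x x = x.
Proof. by apply: val_inj; rewrite /= mulVmx ?S21_valU // mul1mx. Qed.

Lemma S21_op_bij (r : R) (y : S21 r) : bijective (fun x => S21_op x y).
Proof.
exists (fun x => exist _ (val y *m val x *m invmx (val y))
                       (S21_op_inv_subproof x y)) => x;
  apply: val_inj; rewrite /= -!mulmxA ?mulVmx ?mulmxV ?S21_valU // mulmx1;
  by rewrite mulmxA ?mulVmx ?mulmxV ?S21_valU // mul1mx.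
Qed.

Lemma S21_op_distr (r : R) (x y z : S21 r) :
  S21_op (S21_op x y) z = S21_op (S21_op x z) (S21_op y z).
Proof.
apply: val_inj => /=.
have z1 : SL2 (val z) by exact/S21_SL2/set_valP.
have y1 : SL2 (val y) by exact/S21_SL2/set_valP.
rewrite !invmxM ?invmxK //; try by repeat apply: SL2_mul => //; exact: SL2_inv.
by rewrite !mulmxA !mulmxK ?SL2_unit.
Qed.

Definition S21_quandle (r : R) : quandle :=
  Quandle (@S21_op_idem r) (@S21_op_bij r) (@S21_op_distr r).

End ConjugationQuandle.

Section LorentzQuandle.
Variable R : realType.

(* The numerals 0, 1, 2 used as column indices are elements of the ring 'I_3,
   whose values as natural numbers are 0, 1, 2. *)
Definition lorentz (x y : 'rV[R]_3) : R :=
  - (x 0 0 * y 0 0) + x 0 1 * y 0 1 + x 0 2 * y 0 2.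

(* The one-sheeted hyperboloid (two-dimensional de Sitter space). *)
Definition dS2 : set 'rV[R]_3 := [set x | lorentz x x = 1].

Definition reflect_pt (x y : 'rV[R]_3) : 'rV[R]_3 :=
  (2 * lorentz x y) *: y - x.

Lemma lorentz_reflect (x y z : 'rV[R]_3) : lorentz z z = 1 ->
  lorentz (reflect_pt x z) (reflect_pt y z) = lorentz x y.
Proof.
move=> z1; transitivity (lorentz x y +
  4 * lorentz x z * lorentz y z * (lorentz z z - 1)).
  by rewrite /reflect_pt /lorentz !mxE; ring.
by rewrite z1 subrr mulr0 addr0.
Qed.

Lemma reflect_ptK (x y : 'rV[R]_3) : lorentz y y = 1 ->
  reflect_pt (reflect_pt x y) y = x.
Proof.
move=> y1; have -> : reflect_pt (reflect_pt x y) y =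
    x + (4 * lorentz x y * (lorentz y y - 1)) *: y.
  by apply/rowP => i; rewrite /reflect_pt /lorentz !mxE; ring.
by rewrite y1 subrr mulr0 scale0r addr0.
Qed.

Lemma dS2_op_subproof (x y : dS2) : reflect_pt (val x) (val y) \in dS2.
Proof.
apply/mem_set; rewrite /dS2 /= lorentz_reflect; first exact: (set_valP x).
exact: (set_valP y).
Qed.

Definition dS2_op (x y : dS2) : dS2 :=
  exist _ (reflect_pt (val x) (val y)) (dS2_op_subproof x y).

Lemma dS2_op_idem (x : dS2) : dS2_op x x = x.
Proof.
apply: val_inj => /=; have x1 : lorentz (val x) (val x) = 1 := set_valP x.
by rewrite /reflect_pt x1 mulr1 scaler_nat mulr2n addrK.
Qed.

Lemma dS2_op_bij (y : dS2) : bijective (fun x => dS2_op x y).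
Proof.
by exists (fun x => dS2_op x y) => x; apply: val_inj; rewrite /= reflect_ptK //;
  exact: (set_valP y).
Qed.

Lemma dS2_op_distr (x y z : dS2) :
  dS2_op (dS2_op x y) z = dS2_op (dS2_op x z) (dS2_op y z).
Proof.
apply: val_inj => /=; have z1 : lorentz (val z) (val z) = 1 := set_valP z.
rewrite [RHS]/reflect_pt (lorentz_reflect _ _ z1).
by apply/rowP => i; rewrite /reflect_pt /lorentz !mxE; ring.
Qed.

Definition dS2_quandle : quandle :=
  Quandle dS2_op_idem dS2_op_bij dS2_op_distr.

End LorentzQuandle.

(* Main.v *)
(* In the Lorentz quandle every right translation is a reflection, hence an
   involution, a property preserved by isomorphisms. In the conjugation quandle,
   y = diag(e^r, e^-r) acts on x by conjugation, and y^2 commutes only with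
   diagonal matrices, so this translation is not an involution. *)
Require Import Defs.
From mathcomp Require Import all_boot all_order all_algebra.
From mathcomp Require Import classical_sets reals sequences exp.

Set Implicit Arguments.
Unset Strict Implicit.
Unset Printing Implicit Defensive.

Import Order.TTheory GRing.Theory Num.Theory.
Local Open Scope ring_scope.

Definition involutory (X : quandle) : Prop :=
  forall x y : X, qop (qop x y) y = x.

Lemma involutory_iso (X Y : quandle) :
  quandle_isomorphic X Y -> involutory Y -> involutory X.
Proof.
move=> [f [/bij_inj f_inj fM]] invY x y.
by apply: f_inj; rewrite !fM invY.
Qed.

Lemma dS2_involutory (R : realType) : involutory (dS2_quandle R).
Proof.
move=> x y; apply: val_inj; rewrite /= reflect_ptK //.
exact: (set_valP y).
Qed.

(** Acting twice by [y] is conjugation by [y *m y], which fixes [x] exactly when [x] commutes with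
    that square. *)
Lemma S21_involutory_comm (R : realType) (r : R) (x y : 'M[R]_2) :
  involutory (S21_quandle r) -> S21 r x -> S21 r y ->
  x *m (y *m y) = y *m y *m x.
Proof.
move=> inv /mem_set Sx /mem_set Sy.
have yu : y \in unitmx by exact/SL2_unit/(@S21_SL2 _ r)/set_mem.
have /(congr1 val)/= xE := inv (exist _ x Sx) (exist _ y Sy).
by rewrite -{2}xE !mulmxA mulmxK // mulmxV // mul1mx.
Qed.

(** A shear: for nonzero [r], conjugation by it makes [diag_exp r] non-diagonal. *)
Definition unipotent (R : realType) : 'M[R]_2 :=
  \matrix_(i, j) (i <= j)%N%:R.

Lemma unipotent_SL2 (R : realType) : SL2 (unipotent R).
Proof.
(* [is_trig_mx] means lower triangular, hence the transpose. *)
rewrite /SL2 /= -det_tr det_trig; first by rewrite !big_ord_recl big_ord0 !mxE /= !mulr1.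
by apply/is_trig_mxP => i j lt_ij; rewrite !mxE leqNgt lt_ij.
Qed.

(* [invmx (unipotent R) *m diag_exp r *m unipotent R], written out. *)
Definition S21_upper (R : realType) (r : R) : 'M[R]_2 :=
  \matrix_(i, j) if i == 0 then if j == 0 then expR r else expR r - expR (- r)
                 else if j == 0 then 0 else expR (- r).

Lemma S21_upper_mem (R : realType) (r : R) : S21 r (S21_upper r).
Proof.
exists (unipotent R); first exact: unipotent_SL2.
rewrite -mulmxA; apply: (canLR (mulKmx (SL2_unit (unipotent_SL2 R)))).
apply/matrixP => i j; rewrite !mxE !big_ord_recl !big_ord0 !mxE.
case: i => [[|[|//]] ?]; case: j => [[|[|//]] ?];
  by rewrite /= ?(mulr0, mul0r, mulr1, mul1r, addr0, add0r, mulr1n, mulr0n) ?subrK.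
Qed.

Lemma S21_diag_mem (R : realType) (r : R) : S21 r (diag_exp r).
Proof. by exists 1%:M; [rewrite /SL2 /= det1 | rewrite invmx1 mul1mx mulmx1]. Qed.

Lemma S21_not_involutory (R : realType) (r : R) :
  0 < r -> ~ involutory (S21_quandle r).
Proof.
move=> r0 /S21_involutory_comm/(_ (S21_upper_mem r) (S21_diag_mem r)).
(* Only the upper right entries differ: [expR r - expR (- r)] is multiplied by [expR (- r) ^+ 2] on
   the left and by [expR r ^+ 2] on the right. *)
move=> /matrixP/(_ 0 1); rewrite !mulmxA !mxE !big_ord_recl !big_ord0 !mxE.
rewrite !big_ord_recl !big_ord0 !mxE /=.
rewrite !(mulr0, mul0r, addr0, add0r, mulr1n, mulr0n).
have lt_e : expR (- r) < expR r by rewrite ltr_expR gtrN.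
(* The common factor is nonzero, so the two squares would agree. *)
rewrite -mulrA mulrC => /mulIf; rewrite subr_eq0 gt_eqF // => /(_ isT)/eqP.
by rewrite -!expr2 eqrXn2 ?expR_ge0 // lt_eqF.
Qed.

Theorem proposition3p4 (R : realType) (r : R) (hr : 0 < r) :
  ~ quandle_isomorphic (S21_quandle r) (dS2_quandle R).
Proof.
move=> iso; apply: (S21_not_involutory hr).
exact: involutory_iso iso (@dS2_involutory R).
Qed.
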